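(* Let $K$ be a complete discretely valued field with residue field of characteristic different from $2$, and let $D=\left(\frac{a,b}{K}\right)$ be a quaternion division algebra over $K$ with $K$-basis $1,x,y,z$, where $x^2=a$, $y^2=b$, $z=xy=-yx$, and where either $a,b\in\mathcal{O}_K^*$ (the unramified case) or $a\in\mathcal{O}_K^*$ and $b$ is a uniformizer of $K$ (the ramified case). Then the ring $\mathcal{O}_D$ is contained in the $\mathcal{O}_K$-submodule of $D$ generated by $1,x,y,z$.
   Context: $\nu_K:K\setminus\{0\}\to\mathbb{Z}$ is the (normalized) discrete valuation of $K$ and $\mathcal{O}_K$ is its valuation ring. The valuation $\nu_K$ extends uniquely to the valuation $\nu_D:D\setminus\{0\}\to\mathbb{Q}$, $\nu_D(d)=\frac12\nu_K(\mathrm{Nrd}(d))$, where $\mathrm{Nrd}$ is the reduced norm, and $\mathcal{O}_D=\{0\}\cup\{d\in D\setminus\{0\} : \nu_D(d)\ge 0\}$. *)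

(* Defs.v *)
From HB Require Import structures.
From mathcomp Require Import all_boot all_order all_algebra all_field.
From mathcomp Require Import ring zify.

Set Implicit Arguments.
Unset Strict Implicit.
Unset Printing Implicit Defensive.
Import Order.TTheory GRing.Theory Num.Theory.
Local Open Scope quotient_scope.
Local Open Scope ring_scope.

(* The value [nu 0] is unconstrained: [nu] is meaningful on K \ {0} only, and
   every definition below treats 0 separately. *)
Record discrete_valuation (K : fieldType) := DiscreteValuation {
  nu_fun :> K -> int;
  nuM : forall x y : K, x != 0 -> y != 0 -> nu_fun (x * y) = nu_fun x + nu_fun y;
  nuD : forall x y : K, x != 0 -> y != 0 -> x + y != 0 ->
    Num.min (nu_fun x) (nu_fun y) <= nu_fun (x + y);
  nu_normalized : forall n : int, exists2 x : K, x != 0 & nu_fun x = n }.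

Section ValuationRing.
Variables (K : fieldType) (nu : discrete_valuation K).
Implicit Types x y : K.

(* "nu x >= n" with the convention nu 0 = +oo *)
Definition nu_ge (n : int) : {pred K} := [pred x | (x == 0) || (n <= nu x)].

Definition valuation_ring : {pred K} := nu_ge 0.

Definition valuation_unit : {pred K} :=
  [pred x | [&& x != 0, x \in valuation_ring & x^-1 \in valuation_ring]].

Definition uniformizer : {pred K} := [pred x | (x != 0) && (nu x == 1)].

Definition nu_cauchy (u : nat -> K) : Prop :=
  forall n : int, exists N : nat, forall i j : nat,
    (N <= i)%N -> (N <= j)%N -> u i - u j \in nu_ge n.

Definition nu_cvg (u : nat -> K) (l : K) : Prop :=
  forall n : int, exists N : nat, forall i : nat,
    (N <= i)%N -> u i - l \in nu_ge n.

Definition nu_complete : Prop :=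
  forall u : nat -> K, nu_cauchy u -> exists l : K, nu_cvg u l.

Lemma nu1 : nu 1 = 0.
Proof.
have := nuM nu (oner_neq0 K) (oner_neq0 K); rewrite mulr1 => h.
by apply: (addrI (nu 1)); rewrite -h addr0.
Qed.

Lemma nuN1 : nu (-1) = 0.
Proof.
have n0 : (-1 : K) != 0 by rewrite oppr_eq0 oner_neq0.
have := nuM nu n0 n0; rewrite mulrNN mulr1 nu1 -mulr2n => /esym/eqP.
by rewrite mulrn_eq0 /= => /eqP.
Qed.

Lemma nuN x : nu (- x) = nu x.
Proof.
have [->|x0] := eqVneq x 0; first by rewrite oppr0.
by rewrite -mulN1r nuM ?oppr_eq0 ?oner_neq0 // nuN1 add0r.
Qed.

Lemma nuV x : x != 0 -> nu x^-1 = - nu x.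
Proof.
move=> x0; apply/eqP; rewrite -addr_eq0 -nuM ?invr_eq0 //.
by rewrite mulVf // nu1.
Qed.

Lemma nu_geN n x : (- x \in nu_ge n) = (x \in nu_ge n).
Proof. by rewrite !inE oppr_eq0 nuN. Qed.

Lemma nu_geD n x y : x \in nu_ge n -> y \in nu_ge n -> x + y \in nu_ge n.
Proof.
rewrite !inE; have [->|x0] := eqVneq x 0; first by rewrite add0r.
have [->|y0] := eqVneq y 0; first by rewrite addr0 (negPf x0).
have [//|s0 /= hx hy] := eqVneq (x + y) 0.
by apply: le_trans (nuD nu x0 y0 s0); rewrite le_min hx.
Qed.

Lemma nu_geM m n x y :
  x \in nu_ge m -> y \in nu_ge n -> x * y \in nu_ge (m + n).
Proof.
rewrite !inE mulf_eq0; have [//|x0] := eqVneq x 0.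
have [//|y0 /= hx hy] := eqVneq y 0.
by rewrite nuM // lerD.
Qed.

Lemma valuation_ring_subring : subring_closed valuation_ring.
Proof.
split; first by rewrite !inE nu1 lexx orbT.
  by move=> x y hx hy; apply: nu_geD => //; rewrite nu_geN.
by move=> x y hx hy; have := nu_geM hx hy; rewrite addr0.
Qed.
HB.instance Definition _ :=
  GRing.isSubringClosed.Build K valuation_ring valuation_ring_subring.

Record vring := VRing { vring_val : K; _ : vring_val \in valuation_ring }.
HB.instance Definition _ := [isSub for vring_val].
HB.instance Definition _ := [Choice of vring by <:].
HB.instance Definition _ := [SubChoice_isSubComNzRing of vring by <:].

Definition maximal_ideal : {pred vring} := [pred u | \val u \in nu_ge 1].

Lemma maximal_ideal_idealr : idealr_closed maximal_ideal.
Proof.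
split; first by rewrite !inE eqxx.
  by rewrite !inE rmorph1 oner_eq0 nu1.
move=> c u v; rewrite !inE => hu hv; rewrite rmorphD rmorphM.
by apply: nu_geD => //; have := nu_geM (valP c) hu; rewrite add0r.
Qed.
HB.instance Definition _ :=
  isIdealr.Build vring maximal_ideal maximal_ideal_idealr.

Definition residue_field := {ideal_quot maximal_ideal}.
HB.instance Definition _ := GRing.ComNzRing.on residue_field.

Lemma residue_pi0 (u : vring) :
  ((\pi u : {ideal_quot maximal_ideal}) == 0) = (\val u \in nu_ge 1).
Proof. by rewrite piE Quotient.equivE subr0. Qed.

(* The quotient is only registered as a ring; it is indeed a field. *)
Lemma residue_field_inv (u : residue_field) :
  u != 0 -> exists v : residue_field, v * u = 1.
Proof.
rewrite /residue_field in u *; elim/quotW: u => u.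
rewrite residue_pi0 => hu.
have [u0 nu0] : \val u != 0 /\ nu (\val u) = 0.
  move: hu (valP u); rewrite !inE negb_or => /andP[u0]; rewrite (negPf u0) /=.
  by rewrite -ltNge => h1 h2; split=> //; lia.
have hv : (\val u)^-1 \in valuation_ring by rewrite !inE nuV // nu0 orbT.
exists (\pi_{ideal_quot maximal_ideal} (VRing hv)).
rewrite -[LHS]rmorphM -[RHS](rmorph1 (\pi_{ideal_quot maximal_ideal})).
by congr (\pi_{ideal_quot maximal_ideal} _); apply: val_inj; rewrite rmorphM rmorph1 /= mulVf.
Qed.

Definition vring_span (M : lmodType K) (s : seq M) (d : M) : Prop :=
  exists c : 'I_(size s) -> vring, d = \sum_(i < size s) \val (c i) *: s`_i.

End ValuationRing.

Definition division_algebra (K : fieldType) (D : falgType K) : Prop :=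
  forall d : D, d != 0 -> d \is a GRing.unit.

Section Quaternion.
Variables (K : fieldType) (D : falgType K).

(* D is the quaternion algebra (a, b / K), with standard basis 1, x, y, z. *)
Record quaternion_basis (a b : K) (x y z : D) : Prop := QuaternionBasis {
  qb_basis : basis_of {:D} [:: 1; x; y; z];
  qb_xx : x ^+ 2 = a%:A;
  qb_yy : y ^+ 2 = b%:A;
  qb_xy : z = x * y;
  qb_yx : z = - (y * x) }.

Variables (x y z : D).

Definition qcoord (i : 'I_4) (d : D) : K := coord [tuple 1; x; y; z] i d.

Definition qconj (d : D) : D :=
  qcoord 0 d *: 1 - qcoord 1 d *: x - qcoord 2 d *: y - qcoord 3 d *: z.

(* d * qconj d lies in K * 1 (see [nrdE]); the reduced norm of d is the
   corresponding element of K. *)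
Definition nrd (d : D) : K := qcoord 0 (d * qconj d).

Variables (a b : K).
Hypothesis qb : quaternion_basis a b x y z.

Lemma qcoordE d :
  d = qcoord 0 d *: 1 + qcoord 1 d *: x + qcoord 2 d *: y + qcoord 3 d *: z.
Proof.
have h := qb_basis qb.
have /(coord_basis (X := [tuple 1; x; y; z]) h) {1}-> := memvf d.
rewrite !big_ord_recl big_ord0 addr0 /= !addrA /qcoord.
by do !congr (_ + _); congr (coord _ _ _ *: _); apply: val_inj.
Qed.

Lemma qcoord0A (c : K) : qcoord 0 (c%:A) = c.
Proof.
have fr : free [tuple 1; x; y; z] := basis_free (qb_basis qb).
rewrite /qcoord linearZ /= -[X in coord _ _ X]/([tuple 1; x; y; z]`_0).
have -> : (0%R : 'I_4) = Ordinal (isT : 0 < 4)%N by apply: val_inj.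
by rewrite (coord_free (Ordinal (isT : 0 < 4)%N)) //= mulr1.
Qed.

Lemma qmul_conj d : d * qconj d =
  (qcoord 0 d ^+ 2 - a * qcoord 1 d ^+ 2 - b * qcoord 2 d ^+ 2
   + a * b * qcoord 3 d ^+ 2)%:A.
Proof.
rewrite {1}[d]qcoordE /qconj.
move: (qcoord 0 d) (qcoord 1 d) (qcoord 2 d) (qcoord 3 d) => p q r s.
have xx : x * x = a%:A by rewrite -expr2 (qb_xx qb).
have yy : y * y = b%:A by rewrite -expr2 (qb_yy qb).
have yx : y * x = - z by rewrite (qb_yx qb) opprK.
have xy : x * y = z by rewrite (qb_xy qb).
have xz : x * z = a *: y by rewrite -xy mulrA xx -scalerAl mul1r.
have zx : z * x = - (a *: y) by rewrite -xy -mulrA yx mulrN xz.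
have zy : z * y = b *: x by rewrite -xy -mulrA yy -scalerAr mulr1.
have yz : y * z = - (b *: x).
  by rewrite -[z]opprK -yx mulrN mulrA yy -scalerAl mul1r.
have zz : z * z = - (a * b)%:A.
  by rewrite -{1}xy -mulrA yz mulrN -scalerAr xx scalerA mulrC.
pose L c0 c1 c2 c3 : D := c0 *: 1 + c1 *: x + c2 *: y + c3 *: z.
have LD c0 c1 c2 c3 e0 e1 e2 e3 : L c0 c1 c2 c3 + L e0 e1 e2 e3 =
    L (c0 + e0) (c1 + e1) (c2 + e2) (c3 + e3).
  rewrite /L !scalerDl.
  by rewrite addrACA; congr (_ + _); rewrite addrACA; congr (_ + _); rewrite addrACA.
have LZ c c0 c1 c2 c3 : c *: L c0 c1 c2 c3 = L (c * c0) (c * c1) (c * c2) (c * c3).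
  by rewrite /L !scalerDr !scalerA.
have LN c0 c1 c2 c3 : - L c0 c1 c2 c3 = L (- c0) (- c1) (- c2) (- c3).
  by rewrite -scaleN1r LZ !mulN1r.
have L0 c : c%:A = L c 0 0 0 by rewrite /L !scale0r !addr0.
have L1 c : c *: x = L 0 c 0 0 by rewrite /L !scale0r !addr0 add0r.
have L2 c : c *: y = L 0 0 c 0 by rewrite /L !scale0r !addr0 add0r.
have L3 c : c *: z = L 0 0 0 c by rewrite /L !scale0r !add0r.
rewrite !(mulrDl, mulrBr) -!scalerAl -!scalerAr !mul1r !mulr1.
rewrite xx xy xz yx yy yz zx zy zz -[x in LHS]scale1r -[y in LHS]scale1r.
rewrite -[z in LHS]scale1r !(L0, L1, L2, L3).
rewrite !(LN, LZ) !(LN, LD).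
by congr L; ring.
Qed.

Lemma nrdE d : (nrd d)%:A = d * qconj d.
Proof. by rewrite /nrd qmul_conj qcoord0A. Qed.

Lemma nrd_formula d : nrd d =
  qcoord 0 d ^+ 2 - a * qcoord 1 d ^+ 2 - b * qcoord 2 d ^+ 2
  + a * b * qcoord 3 d ^+ 2.
Proof. by rewrite /nrd qmul_conj qcoord0A. Qed.

End Quaternion.

Section QuaternionValuation.
Variables (K : fieldType) (nu : discrete_valuation K).
Variables (D : falgType K) (x y z : D).

Definition nu_quat (d : D) : rat := (nu (nrd x y z d))%:~R / 2.

Definition quat_valuation_ring : {pred D} :=
  [pred d | (d == 0) || (0 <= nu_quat d)].

End QuaternionValuation.

(* Main.v *)
Require Import Defs.
From mathcomp Require Import all_boot all_order all_algebra all_field.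
From mathcomp Require Import ring zify.
Import Order.TTheory GRing.Theory Num.Theory.
Local Open Scope ring_scope.

(** The reduced norm of [p + q x + r y + s z] is the diagonal quadratic form
    [p^2 - a q^2 - b r^2 + a b s^2], and it is anisotropic because D is a
    division algebra.  Over a complete field of residue characteristic
    different from 2, every element of 1 + m is a square
    ([sqrt_one_plus_maximal]).  This forbids cancellation in an anisotropic
    diagonal form: if the valuation of the sum exceeded that of some term
    [c_j v_j^2], the sum of the other terms would be [- c_j v_j^2 (1 + e)] with
    [e] in m, so rescaling [v_j] by a square root of [1 + e] would give a
    nontrivial zero.  Hence every term is at least as divisible as the sum
    ([anisotropic_diag_terms]).

    If the norm is integral, then so are [p^2], [a q^2], [b r^2] and
    [a b s^2].  Their coefficients have valuation 0 or 1, in the unramified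
    as well as in the ramified case, so each coordinate has valuation at least
    -1/2, and hence is integral. *)

(** * Valuations and square roots of principal units *)

Section SquareRoots.
Set Implicit Arguments.
Unset Strict Implicit.
Variables (K : fieldType) (nu : discrete_valuation K).

Lemma nu_ge_weaken (m n : int) (u : K) :
  m <= n -> u \in nu_ge nu n -> u \in nu_ge nu m.
Proof. by rewrite !inE => ? /orP[->//|?]; apply/orP; right; lia. Qed.

Lemma nu_ge_eq0 (u : K) : (forall n : nat, u \in nu_ge nu n) -> u = 0.
Proof.
move=> h; apply/eqP; move: (h (absz (nu u)).+1); rewrite inE.
by case: (u == 0) => //=; lia.
Qed.

Lemma nu_ge0_square_term (c u : K) : c != 0 -> nu c <= 1 ->
  c * u ^+ 2 \in valuation_ring nu -> u \in valuation_ring nu.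
Proof.
move=> c0 hc; rewrite !inE; have [//|u0] := eqVneq u 0.
rewrite expr2 !mulf_eq0 (negPf c0) (negPf u0) /= !nuM ?mulf_neq0 //; lia.
Qed.

Lemma nu2_eq0 : 2%N \notin [pchar (residue_field nu)] ->
  (2 : K) != 0 /\ nu 2 = 0.
Proof.
move=> h.
have h1 : (2 : K) \notin nu_ge nu 1.
  apply: contra h => h; rewrite inE /=.
  have := residue_pi0 (nu := nu) 2%:R; rewrite !rmorph_nat.
  by rewrite h => e; apply: e.
have h2 : (2 : K) \in valuation_ring nu by rewrite rpred_nat.
move: h1 h2; rewrite !inE negb_or => /andP[n0]; rewrite (negPf n0) /= => *.
by split=> //; lia.
Qed.

Hypothesis complete_nu : nu_complete nu.
Hypothesis two_neq0 : (2 : K) != 0.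
Hypothesis nu2 : nu 2 = 0.

(** A solution of [(1 + s)^2 = 1 + e] is a fixed point of [s |-> (e - s^2) / 2],
    which maps m into itself and is contracting there, because
    [s^2 - t^2 = (s - t) (s + t)] with [s + t] in m. *)
Lemma sqrt_one_plus_maximal (e : K) : e \in nu_ge nu 1 ->
  exists2 t : K, t != 0 & t ^+ 2 = 1 + e.
Proof.
move=> he.
pose f (s : K) := (e - s ^+ 2) / 2.
have half n u : u \in nu_ge nu n -> u / 2 \in nu_ge nu n.
  move=> hu; rewrite -[n]addr0; apply: nu_geM => //.
  by rewrite inE nuV // nu2 oppr0 lexx orbT.
have fm s : s \in nu_ge nu 1 -> f s \in nu_ge nu 1.
  move=> hs; apply: half; apply: nu_geD => //; rewrite nu_geN.
  by rewrite expr2; apply: nu_ge_weaken (nu_geM hs hs).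
have fC n s t : s \in nu_ge nu 1 -> t \in nu_ge nu 1 ->
    s - t \in nu_ge nu n -> f s - f t \in nu_ge nu (n + 1).
  move=> hs ht hst.
  have -> : f s - f t = - ((s - t) * (s + t)) / 2 by rewrite /f; field.
  by apply: half; rewrite nu_geN; apply: nu_geM => //; apply: nu_geD.
pose u n := iter n f 0.
have um n : u n \in nu_ge nu 1.
  by elim: n => [|n IH]; [rewrite inE eqxx | apply: fm].
have uC (N k : nat) : u (N + k)%N - u N \in nu_ge nu N.
  elim: N => [|N IH].
    by rewrite subr0; apply: nu_ge_weaken (um _).
  by rewrite -addn1 PoszD addn1 addSn; apply: fC.
have uCN (N i : nat) : (N <= i)%N -> u i - u N \in nu_ge nu N.
  by move=> /subnKC <-.
have [|l hl] := @complete_nu u.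
  move=> n; exists (absz n) => i j hi hj; apply: (@nu_ge_weaken _ (absz n)); first by lia.
  rewrite -[u i](subrK (u (absz n))) -addrA; apply: nu_geD; first exact: uCN.
  by rewrite -nu_geN opprB; apply: uCN.
have hlm : l \in nu_ge nu 1.
  have [N /(_ N (leqnn N)) h] := hl 1.
  by rewrite -[l](subKr (u N)); apply: nu_geD => //; rewrite nu_geN.
have fix_l : f l - l = 0.
  apply: nu_ge_eq0 => n; have [N h] := hl n.
  have -> : f l - l = - (f (u N) - f l) + (u N.+1 - l).
    by rewrite /u iterS -/(u N); ring.
  apply: nu_geD; last exact/h/leqnSn.
  rewrite nu_geN; apply: (@nu_ge_weaken _ (n%:Z + 1)); first by lia.
  exact/fC/h.
have el : (1 + l) ^+ 2 = 1 + e.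
  have -> : (1 + l) ^+ 2 = 1 + e - 2 * (f l - l) by rewrite /f; field.
  by rewrite fix_l mulr0 subr0.
exists (1 + l) => //; apply/eqP => l0.
move: hlm; have -> : l = - 1 by rewrite -[l](addKr 1) l0 addr0.
by rewrite inE oppr_eq0 oner_eq0 nuN1.
Qed.

(** * Anisotropic diagonal forms *)

(** With [e] in m such that [c u^2 + r = - e c u^2], the remainder is
    [r = - c u^2 (1 + e)], so [t] is [u] times a square root of [1 + e]. *)
Lemma dominated_sum_zero (c u r : K) : c * u ^+ 2 != 0 ->
  c * u ^+ 2 + r \in nu_ge nu (nu (c * u ^+ 2) + 1) ->
  exists2 t : K, t != 0 & c * t ^+ 2 + r = 0.
Proof.
move=> g0 hs; have := g0; rewrite mulf_eq0 expf_eq0 /= negb_or => /andP[c0 u0].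
pose e := - (c * u ^+ 2 + r) / (c * u ^+ 2).
have he : e \in nu_ge nu 1.
  apply: (@nu_ge_weaken _ (nu (c * u ^+ 2) + 1 - nu (c * u ^+ 2))); first by lia.
  apply: nu_geM; first by rewrite nu_geN.
  by rewrite inE nuV // lexx orbT.
have [t t0 te] := sqrt_one_plus_maximal he.
exists (u * t); first by rewrite mulf_neq0.
by rewrite exprMn te /e; field; rewrite c0 u0.
Qed.

(** No cancellation can occur: a term less divisible than the sum could be
    rescaled so as to make the sum vanish. *)
Lemma anisotropic_diag_terms (k : nat) (c : 'I_k -> K) :
  (forall v : 'I_k -> K, \sum_i c i * v i ^+ 2 = 0 -> forall i, v i = 0) ->
  forall (n : int) (v : 'I_k -> K), \sum_i c i * v i ^+ 2 \in nu_ge nu n ->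
  forall j, c j * v j ^+ 2 \in nu_ge nu n.
Proof.
move=> aniso n v hs j; apply/negPn/negP; rewrite inE negb_or -ltNge => /andP[g0 lt].
move: hs; rewrite (bigD1 j) //=; set r := \sum_(i | _) _ => hs.
have [|t t0 ht] := @dominated_sum_zero (c j) (v j) r g0.
  by apply: nu_ge_weaken hs; lia.
pose w i := if i == j then t else v i.
suff /aniso/(_ j) : \sum_i c i * w i ^+ 2 = 0.
  by rewrite /w eqxx => /eqP; rewrite (negPf t0).
rewrite (bigD1 j) //= /w eqxx -[RHS]ht; congr (_ + _).
by apply: eq_bigr => i /negPf ->.
Qed.

End SquareRoots.

(** * The reduced norm as a diagonal form *)

Section NormForm.
Set Implicit Arguments.
Unset Strict Implicit.
Variables (K : fieldType) (D : falgType K) (a b : K) (x y z : D).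
Hypothesis qb : quaternion_basis a b x y z.

Definition norm_coef (i : 'I_4) : K := [:: 1; - a; - b; a * b]`_i.

Lemma nrd_diag (d : D) :
  nrd x y z d = \sum_i norm_coef i * qcoord x y z i d ^+ 2.
Proof.
rewrite (nrd_formula qb) !big_ord_recl big_ord0 /norm_coef /=.
have E (i j : 'I_4) : i = j :> nat -> qcoord x y z i d = qcoord x y z j d.
  by move=> /val_inj ->.
rewrite -(E 1 (lift 0 0)) // -(E 2 (lift 0 (lift 0 0))) //.
rewrite -(E 3 (lift 0 (lift 0 (lift 0 0)))) //; ring.
Qed.

Lemma qcoord_sum (v : 'I_4 -> K) i :
  qcoord x y z i (\sum_(j < 4) v j *: [:: 1; x; y; z]`_j) = v i.
Proof.
exact: (coord_sum_free (X := [tuple 1; x; y; z]) v i (basis_free (qb_basis qb))).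
Qed.

Lemma qconjE (d : D) : qconj x y z d =
  \sum_(j < 4) (if j == 0 then qcoord x y z j d else - qcoord x y z j d)
               *: [:: 1; x; y; z]`_j.
Proof.
rewrite /qconj !big_ord_recl big_ord0 /= !scaleNr addr0 !addrA.
by do !congr (_ + _); congr (- _); congr (qcoord _ _ _ _ _ *: _); apply: val_inj.
Qed.

(** [d * qconj d = nrd d] forces [qconj d = 0] when [d] is invertible of norm 0,
    and conjugation only changes signs of coordinates. *)
Lemma nrd_eq0 (d : D) : division_algebra D -> nrd x y z d = 0 -> d = 0.
Proof.
move=> divD h; apply/eqP/negPn/negP => d0.
have := nrdE qb d; rewrite h scale0r => /esym/(congr1 ( *%R d^-1)).
rewrite mulr0 mulKr ?divD // qconjE => c0.
case/eqP: d0; rewrite (qcoordE qb d).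
have q0 i : qcoord x y z i d = 0.
  have := congr1 (qcoord x y z i) c0; rewrite qcoord_sum /qcoord linear0.
  by case: ifP => // _ /eqP; rewrite oppr_eq0 => /eqP.
by rewrite !q0 !scale0r !addr0.
Qed.

Lemma norm_form_anisotropic : division_algebra D ->
  forall v : 'I_4 -> K, \sum_i norm_coef i * v i ^+ 2 = 0 -> forall i, v i = 0.
Proof.
move=> divD v hv i; rewrite -(qcoord_sum v i).
rewrite (_ : \sum_(j < 4) _ = 0) ?/qcoord ?linear0 //.
apply: nrd_eq0 => //; rewrite nrd_diag -[RHS]hv.
by apply: eq_bigr => j _; rewrite qcoord_sum.
Qed.

End NormForm.

(** * Integrality of the coordinates *)

Theorem lemma4p1 (K : fieldType) (nu : discrete_valuation K)
    (complete_nu : nu_complete nu)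
    (residue_char : 2%N \notin [pchar (residue_field nu)])
    (D : falgType K) (a b : K) (x y z : D)
    (division_D : division_algebra D)
    (basis_D : quaternion_basis a b x y z)
    (hab : (a \in valuation_unit nu /\ b \in valuation_unit nu) \/
           (a \in valuation_unit nu /\ b \in uniformizer nu)) :
  forall d : D, d \in quat_valuation_ring nu x y z ->
    vring_span nu [:: 1; x; y; z] d.
Proof.
move=> d hd.
have [two0 nu2] := nu2_eq0 residue_char.
have unitP u : u \in valuation_unit nu -> u != 0 /\ nu u = 0.
  rewrite !inE => /andP[u0]; rewrite invr_eq0 (negPf u0) nuV //= => /andP[? ?].
  by split=> //; lia.
have [a0 nua] : a != 0 /\ nu a = 0 by case: hab => -[/unitP].
have [b0 nub] : b != 0 /\ 0 <= nu b <= 1.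
  by case: hab => -[_]; [case/unitP=> ? -> | rewrite inE => /andP[? /eqP->]].
have coefP i : norm_coef a b i != 0 /\ nu (norm_coef a b i) <= 1.
  case: i => -[|[|[|[|//]]]] i /=; rewrite /norm_coef /= ?oppr_eq0 ?nuN ?nu1.
  - by rewrite oner_neq0.
  - by rewrite nua.
  - by case/andP: nub.
  - by rewrite mulf_neq0 // nuM // nua add0r; case/andP: nub.
have hN : nrd x y z d \in valuation_ring nu.
  move: hd; rewrite inE => /orP[/eqP->|].
    rewrite (nrd_formula basis_D) /qcoord !linear0 expr0n /= !mulr0.
    by rewrite !subr0 addr0 inE eqxx.
  by rewrite /nu_quat pmulr_lge0 // ler0z inE => ->; rewrite orbT.
have int_coord i : qcoord x y z i d \in valuation_ring nu.
  have [c0 c1] := coefP i; apply: nu_ge0_square_term c0 c1 _.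
  move: hN; rewrite (nrd_diag basis_D) => hN.
  have aniso := norm_form_anisotropic basis_D division_D.
  exact: (anisotropic_diag_terms complete_nu two0 nu2 aniso
    (v := fun j => qcoord x y z j d) hN).
exists (fun i => VRing (int_coord i)).
rewrite {1}(qcoordE basis_D d) !big_ord_recl big_ord0 addr0 /= !addrA.
by do !congr (_ + _); congr (qcoord _ _ _ _ _ *: _); apply: val_inj.
Qed.
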